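(* Let $P$ be a poset and let $\mathcal{U}(P)$ be the set of all upsets of $P$, equipped with the partial order $\sqsubseteq$ defined by $$U\sqsubseteq V \iff \partial\mathrm{oc}(U)\supseteq\partial\mathrm{oc}(V)\ \text{ and }\ U\subseteq V .$$ For $U\in\mathcal{U}(P)$ let $\overline{U}:=P\setminus D(\partial\mathrm{oc}(U))$. Then $U\mapsto\overline{U}$ is a closure operator on the poset $(\mathcal{U}(P),\sqsubseteq)$.
   Context: A subset $U\subseteq P$ is an upset if $x\geq y\in U$ implies $x\in U$. For $A\subseteq P$, $D(A)=\{x\in P: x\leq a\text{ for some }a\in A\}$. For an upset $U$, $\partial\mathrm{oc}(U):=\max(P\setminus U)$ is the set of maximal elements of $P\setminus U$ (possibly empty). A closure operator on a poset $(Q,\sqsubseteq)$ is a map $q\mapsto\overline{q}$ from $Q$ to $Q$ which is extensive ($q\sqsubseteq\overline{q}$), monotone ($q\sqsubseteq r\Rightarrow\overline{q}\sqsubseteq\overline{r}$) and idempotent ($\overline{\overline{q}}=\overline{q}$). *)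

(* Defs.v *)
From HB Require Import structures.
From mathcomp Require Import all_boot all_order.
From mathcomp Require Import boolp classical_sets.

Set Implicit Arguments.
Unset Strict Implicit.
Unset Printing Implicit Defensive.

Import Order.TTheory.

Local Open Scope classical_set_scope.
Local Open Scope order_scope.

Definition closure_operator (d : Order.disp_t) (Q : porderType d)
    (f : Q -> Q) : Prop :=
  [/\ forall q, q <= f q,
      forall q r, q <= r -> f q <= f r &
      forall q, f (f q) = f q].

Section Upsets.
Variables (d : Order.disp_t) (P : porderType d).

Definition is_upset (U : set P) : Prop :=
  forall x y, U y -> y <= x -> U x.

Record upset : Type := Upset {
  upset_set :> set P;
  upsetP : is_upset upset_set
}.

Definition maximals (A : set P) : set P :=
  [set x | A x /\ forall y, A y -> x <= y -> y = x].

Definition oc_boundary (U : set P) : set P := maximals (~` U).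

(* [down A], from classical_sets, is the downset D(A) generated by A. *)
Lemma is_upset_setC_down (A : set P) : is_upset (~` down A).
Proof.
move=> x y nDy yx [a [Aa xa]]; apply: nDy.
by exists a; split=> //; exact: le_trans yx xa.
Qed.

Definition upset_closure (U : upset) : upset :=
  @Upset (~` down (oc_boundary U)) (@is_upset_setC_down (oc_boundary U)).

Lemma upset_eq (U V : upset) : upset_set U = upset_set V -> U = V.
Proof.
case: U V => [U upU] [V upV] /= eqUV; rewrite -eqUV in upV *.
by congr Upset; exact: Prop_irrelevance.
Qed.

Definition upset_le (U V : upset) : bool :=
  `[< oc_boundary V `<=` oc_boundary U /\ U `<=` V >].

Lemma upset_le_refl : reflexive upset_le.
Proof. by move=> U; apply/asboolP; split. Qed.

Lemma upset_le_anti : antisymmetric upset_le.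
Proof.
move=> U V /andP[/asboolP[_ UV] /asboolP[_ VU]].
by apply: upset_eq; apply/seteqP; split.
Qed.

Lemma upset_le_trans : transitive upset_le.
Proof.
move=> V U W /asboolP[bUV UV] /asboolP[bVW VW]; apply/asboolP; split.
  exact: subset_trans bVW bUV.
exact: subset_trans UV VW.
Qed.

End Upsets.

Fact upset_display : Order.disp_t.
Proof. exact: (Order.Disp tt tt). Qed.

HB.instance Definition _ (d : Order.disp_t) (P : porderType d) :=
  gen_eqMixin (upset P).
HB.instance Definition _ (d : Order.disp_t) (P : porderType d) :=
  gen_choiceMixin (upset P).
HB.instance Definition _ (d : Order.disp_t) (P : porderType d) :=
  @Order.Le_isPOrder.Build upset_display (upset P) (@upset_le d P)
    (@upset_le_refl d P) (@upset_le_anti d P) (@upset_le_trans d P).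

Lemma upset_leP (d : Order.disp_t) (P : porderType d) (U V : upset P) :
  reflect (oc_boundary V `<=` oc_boundary U /\ U `<=` V) (U <= V).
Proof. exact: asboolP. Qed.

(* Main.v *)
(* The maximal elements of a set form an antichain [M], and an antichain is
   recovered as the set of maximal elements of the downset it generates. Hence
   passing from [U] to its closure does not change the boundary, and the
   closure depends antitonically on the boundary alone. *)
Require Import Defs.
From mathcomp Require Import all_boot all_order.
From mathcomp Require Import boolp classical_sets.

Import Order.TTheory.
Local Open Scope classical_set_scope.
Local Open Scope order_scope.

Lemma subset_down (d : Order.disp_t) (P : porderType d) (A : set P) :
  A `<=` down A.
Proof. by move=> x Ax; exists x. Qed.

Lemma down_subset (d : Order.disp_t) (P : porderType d) (A B : set P) :
  A `<=` B -> down A `<=` down B.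
Proof. by move=> AB x [a [Aa xa]]; exists a; split=> //; exact: AB. Qed.

(** A maximal point of the downset lies below some generator, itself in the downset, so it equals
    that generator. *)
Lemma maximals_down_maximals (d : Order.disp_t) (P : porderType d)
    (A : set P) : maximals (down (maximals A)) = maximals A.
Proof.
apply/seteqP; split=> [x [[a [Ma xa]] xmax]|x Mx].
  by rewrite -(xmax a (subset_down _ _ _ _ Ma) xa).
split=> [|y [a [[Aa _] ya]] xy]; first exact: subset_down.
(* Here [x <= y <= a] with [a] in [A]: maximality of [x] in [A] collapses the chain. *)
have ax : a = x by case: Mx => _; apply=> //; exact: le_trans xy ya.
by apply/le_anti; rewrite xy -{1}ax ya.
Qed.

Lemma oc_boundary_closure (d : Order.disp_t) (P : porderType d)
    (U : upset P) : oc_boundary (upset_closure U) = oc_boundary U.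
Proof. by rewrite /oc_boundary /= setCK maximals_down_maximals. Qed.

(** A boundary point above a point of [U] would lie in [U], since [U] is an upset, yet boundary
    points lie outside [U]. *)
Lemma subset_upset_closure (d : Order.disp_t) (P : porderType d)
    (U : upset P) : U `<=` upset_closure U.
Proof. by move=> x Ux [a [[nUa _] xa]]; apply: nUa; exact: upsetP Ux xa. Qed.

Theorem theorem4p5 (d : Order.disp_t) (P : porderType d) :
  closure_operator (@upset_closure d P).
Proof.
split=> [U|U V /upset_leP[bVU _]|U].
- apply/upset_leP; rewrite oc_boundary_closure; split=> //.
  exact: subset_upset_closure.
- apply/upset_leP; rewrite !oc_boundary_closure; split=> //.
  by apply: subsetC; exact: down_subset.
- by apply: upset_eq; rewrite /= -/(upset_set (upset_closure U)) oc_boundary_closure.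
Qed.
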